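(* Let $M$ be a matrix-valued rational function analytic in the exterior (including infinity) and on the boundary of the unit disk, with minimal realization $M(z)=D+C(zI-A)^{-1}B$. Let $(h_k)_{k\in\mathbb Z}$ be given by $h_0=D$, $h_k=CA^{k-1}B$ for $k\ge1$, and $h_k=0$ for $k<0$, and let \[ \Gamma=\sum_{u=0}^\infty A^{*u}C^*CA^u,\qquad Y=D^*C+B^*\Gamma A . \] Let $(c_n)_{n\in\mathbb Z}$ be defined by \[ M(z)^*M(z)=\sum_{n\in\mathbb Z}c_nz^{-n},\qquad z\in\mathbb T . \] Then \[ c_n=\sum_{j\in\mathbb Z}h_j^*h_{j+n},\qquad n\in\mathbb Z, \] and therefore \[ c_n=\begin{cases}B^*A^{*(-n-1)}Y^*,& n<0,\\ D^*D+B^*\Gamma B,& n=0,\\ YA^{n-1}B,& n>0.\end{cases} \]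
   Context: $\mathbb T$ is the unit circle and $*$ denotes the conjugate transpose. A realization is minimal if the size of $A$ is the smallest possible; under the stated analyticity, all eigenvalues of $A$ lie in the open unit disk, so the series for $\Gamma$ converges. The $h_k$ are the Markov parameters of $M$, i.e. $M(z)=h_0+\sum_{k\ge1}h_kz^{-k}$ near infinity. The series $\sum_n c_nz^{-n}$ is the absolutely convergent Fourier expansion on $\mathbb T$. *)

(* Defs.v *)
From mathcomp Require Import all_boot all_order all_algebra.
From mathcomp Require Import complex.
From mathcomp Require Import all_classical all_reals all_analysis.

Set Implicit Arguments.
Unset Strict Implicit.
Unset Printing Implicit Defensive.

Import Order.TTheory GRing.Theory Num.Theory.
Import numFieldNormedType.Exports.

Local Open Scope classical_set_scope.
Local Open Scope ring_scope.
Local Open Scope complex_scope.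
Local Open Scope sesquilinear_scope.

(* The alias lets the topology and norm that the analysis library puts on a
   numFieldType be inferred; they are not found on R[i] directly. *)
Definition Cplx (R : realType) : numClosedFieldType := R[i].

Section MatrixFunctions.
Variable R : realType.
Local Notation C := (Cplx R).

(* A rational matrix function is represented by a total function on C whose
   values are unconstrained at finitely many points (at its poles).  Identities
   between rational functions are therefore identities off a finite set. *)
Definition rational_mxfun (p q : nat) (M : C -> 'M[C]_(p, q)) : Prop :=
  forall i j, exists num den : {poly C},
    den != 0 /\ finite_set [set z | M z i j != num.[z] / den.[z]].

(* [derivable f w 1] over the base field C is complex differentiability. *)
Definition analytic_at (p q : nat) (f : C -> 'M[C]_(p, q)) (z : C) : Prop :=
  \forall w \near z, derivable f w 1.

(* w |-> f (1 / w) extends analytically to w = 0, with value L there. *)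
Definition analytic_at_infinity (p q : nat) (f : C -> 'M[C]_(p, q)) : Prop :=
  exists L : 'M[C]_(p, q),
    analytic_at (fun w => if w == 0 then L else f w^-1) 0.

Definition realization (p q n : nat) (M : C -> 'M[C]_(p, q))
    (A : 'M[C]_n) (B : 'M[C]_(n, q)) (K : 'M[C]_(p, n)) (D : 'M[C]_(p, q)) :
    Prop :=
  finite_set [set z : C | M z != D + K *m invmx (z%:M - A) *m B].

Definition minimal_realization (p q n : nat) (M : C -> 'M[C]_(p, q))
    (A : 'M[C]_n) (B : 'M[C]_(n, q)) (K : 'M[C]_(p, n)) (D : 'M[C]_(p, q)) :
    Prop :=
  realization M A B K D /\
  forall (n' : nat) (A' : 'M[C]_n') (B' : 'M[C]_(n', q)) (K' : 'M[C]_(p, n'))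
    (D' : 'M[C]_(p, q)), realization M A' B' K' D' -> (n <= n')%N.

Definition markov_param (p q n : nat) (A : 'M[C]_n) (B : 'M[C]_(n, q))
    (K : 'M[C]_(p, n)) (D : 'M[C]_(p, q)) (k : int) : 'M[C]_(p, q) :=
  if k == 0 then D
  else if 0 < k then K *m A ^+ `|(k - 1)%R|%N *m B
  else 0.

Definition gramian_term (p n : nat) (A : 'M[C]_n) (K : 'M[C]_(p, n)) (u : nat) :
    'M[C]_n :=
  (A ^t*) ^+ u *m K ^t* *m K *m A ^+ u.

(* Meaningful when the series converges; [lim] is total. *)
Definition gramian (p n : nat) (A : 'M[C]_n) (K : 'M[C]_(p, n)) : 'M[C]_n :=
  limn (series (gramian_term A K)).

(* The series of all u k, k : int, converges absolutely with sum s.  The terms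
   are split as k = 0, 1, 2, ... and k = -1, -2, ... (Negz k is - k.+1). *)
Definition zsum_to (p q : nat) (u : int -> 'M[C]_(p, q)) (s : 'M[C]_(p, q)) :
    Prop :=
  let upos := fun k : nat => u (Posz k) in
  let uneg := fun k : nat => u (Negz k) in
  [/\ cvgn [normed series upos], cvgn [normed series uneg] &
      exists spos sneg : 'M[C]_(p, q),
        [/\ series upos @ \oo --> spos, series uneg @ \oo --> sneg &
            s = spos + sneg]].

Definition fourier_expansion (q : nat) (F : C -> 'M[C]_q)
    (c : int -> 'M[C]_q) : Prop :=
  forall z : C, `|z| = 1 -> zsum_to (fun n : int => z ^ (- n) *: c n) (F z).

End MatrixFunctions.

(* Main.v *)
(* Minimality gives W_i, Z_j with 1 = sum_i W_i C A^i and 1 = sum_j A^j B Z_j, so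
   a finite limit of M at a point forces (z - A)^-1 to have a finite limit there:
   no pole cancels, and every eigenvalue of A lies in the open unit disk.  Powers
   of A are then absolutely summable: by Cayley-Hamilton a product of factors
   A - a with |a| < 1 vanishes, and the factors can be peeled off one at a time.
   On the circle (z - A)^-1 = sum_k z^(-k-1) A^k, and the Stein equation
   Gamma = C* C + A* Gamma A turns M(z)* M(z) into
   D* D + B* Gamma B + Y (z - A)^-1 B + (Y (z - A)^-1 B)*, whose expansion is
   explicit.  Absolutely convergent expansions on the circle are unique because
   averaging over roots of unity bounds the coefficients of a Laurent polynomial
   by its maximum on the circle. *)

Require Import Defs.
From mathcomp Require Import all_boot all_order all_algebra.
From mathcomp Require Import cyclic separable cyclotomic zify ring.
From mathcomp Require Import complex.
From mathcomp Require Import all_classical all_reals all_analysis.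

Set Implicit Arguments.
Unset Strict Implicit.
Unset Printing Implicit Defensive.

Import Order.TTheory GRing.Theory Num.Theory.
Import numFieldNormedType.Exports.

Local Open Scope classical_set_scope.
Local Open Scope ring_scope.
Local Open Scope sesquilinear_scope.

(** * Limits of matrices *)

(** Summability estimates use this norm because, unlike the maximum norm [|A|], it is
    submultiplicative for [*m]; it is also invariant under the adjoint. *)
Definition l1norm (K : numDomainType) (m n : nat) (A : 'M[K]_(m, n)) : K :=
  \sum_i \sum_j `|A i j|.

Section L1norm.
Variable K : numDomainType.

Lemma l1norm_ge0 (m n : nat) (A : 'M[K]_(m, n)) : 0 <= l1norm A.
Proof. by apply: sumr_ge0 => i _; apply: sumr_ge0 => j _. Qed.

Lemma l1norm0 (m n : nat) : l1norm (0 : 'M[K]_(m, n)) = 0.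
Proof. by apply: big1 => i _; apply: big1 => j _; rewrite mxE normr0. Qed.

Lemma normr_coord_le_l1norm (m n : nat) (A : 'M[K]_(m, n)) i j :
  `|A i j| <= l1norm A.
Proof.
rewrite /l1norm (bigD1 i) //= (bigD1 j) //= -addrA lerDl.
by apply: addr_ge0; apply: sumr_ge0 => *; rewrite ?sumr_ge0.
Qed.

Lemma ler_l1normD (m n : nat) (A B : 'M[K]_(m, n)) :
  l1norm (A + B) <= l1norm A + l1norm B.
Proof.
rewrite /l1norm -big_split; apply: ler_sum => i _ /=.
by rewrite -big_split; apply: ler_sum => j _ /=; rewrite mxE ler_normD.
Qed.

Lemma l1normZ (m n : nat) (a : K) (A : 'M[K]_(m, n)) :
  l1norm (a *: A) = `|a| * l1norm A.
Proof.
rewrite /l1norm mulr_sumr; apply: eq_bigr => i _.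
by rewrite mulr_sumr; apply: eq_bigr => j _; rewrite mxE normrM.
Qed.

Lemma ler_l1normM (m n p : nat) (A : 'M[K]_(m, n)) (B : 'M[K]_(n, p)) :
  l1norm (A *m B) <= l1norm A * l1norm B.
Proof.
rewrite /l1norm mulr_suml; apply: ler_sum => i _.
apply: (@le_trans _ _ (\sum_j \sum_k `|A i k| * `|B k j|)).
  apply: ler_sum => j _; rewrite mxE; apply: le_trans (ler_norm_sum _ _ _) _.
  by apply: ler_sum => k _; rewrite normrM.
rewrite exchange_big mulr_suml; apply: ler_sum => k _ /=.
rewrite -mulr_sumr ler_wpM2l // [leRHS](bigD1 k) //= lerDl.
by apply: sumr_ge0 => l _; apply: sumr_ge0.
Qed.

End L1norm.

Lemma l1norm_adjoint (K : numClosedFieldType) (m n : nat) (A : 'M[K]_(m, n)) :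
  l1norm (A ^t*) = l1norm A.
Proof.
rewrite /l1norm exchange_big; apply: eq_bigr => i _.
by apply: eq_bigr => j _; rewrite !mxE norm_conjC.
Qed.

Lemma normr_mx_le_l1norm (K : numFieldType) (m n : nat) (A : 'M[K]_(m, n)) :
  `|A| <= l1norm A.
Proof.
have [A0|A0] := eqVneq (mx_norm A) 0.
  by rewrite -[`|A|]/(mx_norm A) A0 l1norm_ge0.
have [[i j] /= Aij] := mx_norm_neq0 A0.
by rewrite -[`|A|]/(mx_norm A) Aij normr_coord_le_l1norm.
Qed.

Section MatrixLimits.
Variables (K : numFieldType) (T : Type) (F : set_system T).
Hypothesis FF : Filter F.

Lemma cvg_mx (m n : nat) (f : T -> 'M[K]_(m, n)) (L : 'M[K]_(m, n)) :
  (forall i j, f x i j @[x --> F] --> L i j) -> f x @[x --> F] --> L.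
Proof.
(* A neighbourhood of [L] contains a product of entrywise neighbourhoods [P i j], and the entries
   are finite in number. *)
move=> fL S [P LP PS].
have : \forall x \near F, forall i j, P i j (f x i j).
  apply: filter_forall => i; apply: filter_forall => j.
  exact: fL (LP i j).
by apply: filterS => x Px; apply: PS.
Qed.

Lemma cvg_coord (m n : nat) (f : T -> 'M[K]_(m, n)) (L : 'M[K]_(m, n)) i j :
  f x @[x --> F] --> L -> f x i j @[x --> F] --> L i j.
Proof.
move=> fL; apply: (cvg_comp f (fun A : 'M[K]_(m, n) => A i j) fL).
exact: coord_continuous.
Qed.

Lemma cvgr_sum (V : normedModType K) (I : Type) (r : seq I) (P : pred I)
    (f : I -> T -> V) (l : I -> V) :
  (forall i, P i -> f i x @[x --> F] --> l i) ->
  \sum_(i <- r | P i) f i x @[x --> F] --> \sum_(i <- r | P i) l i.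
Proof. by move=> fl; apply: cvg_big => //; exact: add_continuous. Qed.

Lemma cvg_mulmx (m n p : nat) (f : T -> 'M[K]_(m, n)) (g : T -> 'M[K]_(n, p))
    (L : 'M[K]_(m, n)) (N : 'M[K]_(n, p)) :
  f x @[x --> F] --> L -> g x @[x --> F] --> N ->
  f x *m g x @[x --> F] --> L *m N.
Proof.
move=> fL gN; apply: cvg_mx => i j; rewrite mxE.
under eq_fun do rewrite mxE.
by apply: cvgr_sum => k _; apply: cvgM; apply: cvg_coord.
Qed.

End MatrixLimits.

Lemma cvg_adjoint (K : numClosedFieldType) (T : Type) (F : set_system T)
    (m n : nat) (f : T -> 'M[K]_(m, n)) (L : 'M[K]_(m, n)) : Filter F ->
  f x @[x --> F] --> L -> (f x) ^t* @[x --> F] --> L ^t*.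
Proof.
move=> FF fL; apply: cvg_mx => i j; rewrite !mxE.
under eq_fun do rewrite !mxE.
have /cvgrPdist_lt fji := cvg_coord fL (i := j) (j := i).
apply/cvgrPdist_lt => e /fji; apply: filterS => x.
by rewrite -rmorphB norm_conjC.
Qed.

(** * Absolutely convergent series *)

Section ComplexSeries.
Variable R : realType.
Local Notation C := (Cplx R).

Lemma cvg_real_complex (u : nat -> R) (l : R) :
  u k @[k --> \oo] --> l ->
  ((u k)%:C%C : C) @[k --> \oo] --> (l%:C%C : C).
Proof.
move=> /cvgrPdist_lt ul; apply/cvgrPdist_lt => e e0.
(* Being positive in [Cplx R] includes being real, so [e] is the image of a positive real number. *)
have eR : e = (complex.Re e)%:C%C by rewrite RRe_real // gtr0_real.
have /ul : 0 < complex.Re e by rewrite -ltcR -eR.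
apply: filterS => k; rewrite eR -rmorphB /= => h.
by rewrite normc_def /= expr0n /= addr0 sqrtr_sqr ltcR.
Qed.

Lemma normr_Re (z : C) : `|z| = (complex.Re `|z|)%:C%C.
Proof. by rewrite RRe_real // normr_real. Qed.

Lemma normr_Im_le (z : C) : `|complex.Im z|%:C%C <= `|z|.
Proof.
have := normc_ge_Re (z * 'i%C); rewrite ReiNIm normrN normrM.
by rewrite (normc_def 'i%C) /= expr0n expr1n add0r sqrtr1 mulr1.
Qed.

(** The partial sums of the moduli are nondecreasing and bounded in [R], hence converge. They
    dominate the series of real and of imaginary parts, which therefore converge too. *)
Lemma is_cvg_series_complex (u : nat -> C) (B : C) :
  (forall N, \sum_(k < N) `|u k| <= B) ->
  cvgn [normed series u] /\ cvgn (series u).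
Proof.
move=> uB.
pose a k := complex.Re `|u k|.
have aE k : `|u k| = (a k)%:C%C by exact: normr_Re.
have a0 k : 0 <= a k by rewrite -lecR -aE; exact: normr_ge0.
have sumE (v : nat -> R) N :
    \sum_(0 <= k < N) (v k)%:C%C = (\sum_(0 <= k < N) v k)%:C%C :> C.
  by rewrite rmorph_sum.
have a_cvg : cvgn (series a).
  apply: nondecreasing_is_cvgn.
    move=> m n mn; rewrite /series /= (big_cat_nat (leq0n m) mn) /= lerDl.
    by apply: sumr_ge0.
  exists (complex.Re B) => _ [N _ <-].
  have := uB N; rewrite -(big_mkord xpredT (fun k => `|u k|)) /series /=.
  under eq_bigr do rewrite aE.
  by rewrite sumE lecE => /andP[_].
have part_cvg (f : C -> R) : (forall z, `|f z|%:C%C <= `|z|) ->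
    cvgn (series (f \o u)).
  move=> fle; apply: normed_cvg; apply: (series_le_cvg _ a0 _ a_cvg) => k //=.
  by rewrite -lecR -aE; exact: fle.
split.
  apply/cvg_ex; exists ((limn (series a))%:C%C : C).
  rewrite [X in X @ _ --> _](_ : _ = fun N => (series a N)%:C%C : C).
    exact: cvg_real_complex a_cvg.
  apply/funext => N; rewrite /series /= -sumE.
  by apply: eq_bigr => k _; rewrite aE.
have reC := part_cvg _ (@normc_ge_Re R).
have imC := part_cvg _ normr_Im_le.
apply/cvg_ex; exists ((limn (series (@complex.Re R \o u)))%:C%C +
   'i%C * (limn (series (@complex.Im R \o u)))%:C%C : C).
rewrite [X in X @ _ --> _](_ : _ = fun N =>
   ((series (@complex.Re R \o u) N)%:C%C : C) +
   ('i%C : C) * ((series (@complex.Im R \o u) N)%:C%C : C)).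
  by apply: cvgD; [|apply: cvgMr]; apply: cvg_real_complex.
apply/funext => N; rewrite /series /= -!sumE mulr_sumr -big_split /=.
by apply: eq_bigr => k _; exact: complexE.
Qed.

End ComplexSeries.

Section MatrixSeries.
Variable R : realType.
Local Notation C := (Cplx R).

(** Stated as a bound on partial sums, so that comparison arguments need no limits; convergence is
    recovered entrywise from completeness. *)
Definition abs_summable (m n : nat) (u : nat -> 'M[C]_(m, n)) : Prop :=
  exists B : C, forall N, \sum_(k < N) l1norm (u k) <= B.

Lemma abs_summable_le (m n m' n' : nat) (u : nat -> 'M[C]_(m, n))
    (v : nat -> 'M[C]_(m', n')) (c : C) : 0 <= c ->
  (forall k, l1norm (v k) <= c * l1norm (u k)) ->
  abs_summable u -> abs_summable v.
Proof.
move=> c0 vu [B uB]; exists (c * B) => N.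
apply: (@le_trans _ _ (\sum_(k < N) c * l1norm (u k))); first exact: ler_sum.
by rewrite -mulr_sumr ler_wpM2l.
Qed.

Lemma abs_summable_cons (m n : nat) (u : nat -> 'M[C]_(m, n)) :
  abs_summable (fun k => u k.+1) -> abs_summable u.
Proof.
case=> B uB; exists (l1norm (u 0%N) + B) => -[|N].
  rewrite big_ord0 addr_ge0 ?l1norm_ge0 //.
  by have := uB 0%N; rewrite big_ord0.
by rewrite big_ord_recl /= lerD2l; apply: uB.
Qed.

Lemma abs_summable_bounded (m n : nat) (u : nat -> 'M[C]_(m, n)) :
  abs_summable u -> exists2 B : C, 0 <= B & forall k, l1norm (u k) <= B.
Proof.
case=> B uB; exists B.
  by have := uB 0%N; rewrite big_ord0.
move=> k; apply: le_trans (uB k.+1); rewrite big_ord_recr /= lerDr.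
by apply: sumr_ge0 => i _; apply: l1norm_ge0.
Qed.

Lemma is_cvg_normed_series_mx (m n : nat) (u : nat -> 'M[C]_(m, n)) :
  abs_summable u -> cvgn [normed series u].
Proof.
case=> B uB.
have [|h _] := @is_cvg_series_complex R (fun k => `|u k|) B.
  move=> N; apply: le_trans (uB N); apply: ler_sum => k _.
  by rewrite normr_id normr_mx_le_l1norm.
rewrite (_ : [normed series u] = [normed series (fun k => `|u k| : C)]) //.
by apply/funext => N; apply: eq_bigr => k _ /=; rewrite normr_id.
Qed.

Lemma is_cvg_series_mx (m n : nat) (u : nat -> 'M[C]_(m, n)) :
  abs_summable u -> cvgn (series u).
Proof.
case=> B uB.
have c i j : cvgn (series (fun k => u k i j)).
  apply: (proj2 (@is_cvg_series_complex R _ B _)) => N.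
  apply: le_trans (uB N); apply: ler_sum => k _.
  exact: normr_coord_le_l1norm.
apply/cvg_ex; exists (\matrix_(i, j) limn (series (fun k => u k i j))).
apply: cvg_mx => i j; rewrite mxE.
rewrite (_ : (fun N => series u N i j) = series (fun k => u k i j)).
  exact: c i j.
by apply/funext => N; rewrite /series /= summxE.
Qed.

Definition has_sum (m n : nat) (u : nat -> 'M[C]_(m, n)) (s : 'M[C]_(m, n)) :=
  abs_summable u /\ series u @ \oo --> s.

Lemma abs_summable_has_sum (m n : nat) (u : nat -> 'M[C]_(m, n)) :
  abs_summable u -> has_sum u (limn (series u)).
Proof. by move=> us; split => //; apply: is_cvg_series_mx. Qed.

Lemma has_sum_unique (m n : nat) (u : nat -> 'M[C]_(m, n)) s t :
  has_sum u s -> has_sum u t -> s = t.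
Proof. by move=> [_ us] [_ ut]; apply: (cvg_unique _ us ut); exact: norm_hausdorff. Qed.

Lemma has_sum0 (m n : nat) : has_sum (fun=> 0 : 'M[C]_(m, n)) 0.
Proof.
split; first by exists 0 => N; rewrite big1 // => k _; rewrite l1norm0.
rewrite [series _](_ : _ = cst 0); first exact: cvg_cst.
by apply/funext => N; rewrite /series /= big1.
Qed.

Lemma has_sum_cons (m n : nat) (u : nat -> 'M[C]_(m, n)) s :
  has_sum (fun k => u k.+1) s -> has_sum u (u 0%N + s).
Proof.
move=> [us uS]; split; first exact: abs_summable_cons.
rewrite -cvg_shiftS [X in X @ _ --> _](_ : _ =
    fun N => u 0%N + series (fun k => u k.+1) N).
  by apply: cvgD uS; exact: cvg_cst.
by apply/funext => N; rewrite /series /= big_nat_recl.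
Qed.

Lemma has_sum_mulmx (m n p q : nat) (L : 'M[C]_(p, m)) (u : nat -> 'M[C]_(m, n))
    (N : 'M[C]_(n, q)) s :
  has_sum u s -> has_sum (fun k => L *m u k *m N) (L *m s *m N).
Proof.
move=> [us uS]; split.
  apply: (@abs_summable_le _ _ _ _ u _ (l1norm L * l1norm N)) us.
    by rewrite mulr_ge0 ?l1norm_ge0.
  move=> k; apply: le_trans (ler_l1normM _ _) _; rewrite mulrAC.
  by rewrite ler_wpM2r ?l1norm_ge0 ?ler_l1normM.
rewrite [series _](_ : _ = fun k => L *m series u k *m N).
  by apply: cvg_mulmx; [apply: cvg_mulmx|]; rewrite //; exact: cvg_cst.
by apply/funext => k; rewrite /series /= mulmx_sumr mulmx_suml.
Qed.

Lemma adjoint_sum (m n : nat) (I : Type) (r : seq I) (P : pred I)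
    (F : I -> 'M[C]_(m, n)) :
  (\sum_(i <- r | P i) F i) ^t* = \sum_(i <- r | P i) (F i) ^t*.
Proof. by rewrite !raddf_sum. Qed.

Lemma has_sum_adjoint (m n : nat) (u : nat -> 'M[C]_(m, n)) s :
  has_sum u s -> has_sum (fun k => (u k) ^t*) (s ^t*).
Proof.
move=> [us uS]; split.
  by apply: (@abs_summable_le _ _ _ _ u _ 1) us => // k;
     rewrite mul1r l1norm_adjoint.
rewrite [series _](_ : _ = fun k => (series u k) ^t*); first exact: cvg_adjoint.
by apply/funext => k; rewrite /series /= adjoint_sum.
Qed.

Lemma zsum_toI (m n : nat) (u : int -> 'M[C]_(m, n)) (s t : 'M[C]_(m, n)) :
  has_sum (fun k => u (Posz k)) s -> has_sum (fun k => u (Negz k)) t ->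
  zsum_to u (s + t).
Proof.
move=> [us uS] [vs vS]; split; try exact: is_cvg_normed_series_mx.
by exists s, t.
Qed.

End MatrixSeries.

(** * Powers and resolvents of stable matrices *)

Section PowerSeries.
Variable R : realType.
Local Notation C := (Cplx R).

(* The partial sums S_N of [l1norm (x k)] satisfy
   S_N <= l1norm (x 0) + `|a| S_N + B. *)
Lemma abs_summable_recurrence (m n : nat) (x : nat -> 'M[C]_(m, n)) (a : C) :
  `|a| < 1 -> abs_summable (fun k => x k.+1 - a *: x k) -> abs_summable x.
Proof.
move=> a1 [B xB]; exists ((l1norm (x 0%N) + B) / (1 - `|a|)) => N.
rewrite ler_pdivlMr ?subr_gt0 // mulrBr mulr1 lerBlDr -addrA.
apply: (@le_trans _ _ (\sum_(k < N.+1) l1norm (x k))).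
  by rewrite big_ord_recr /= lerDl l1norm_ge0.
rewrite big_ord_recl /= lerD2l mulr_suml.
apply: (@le_trans _ _ (\sum_(k < N) (l1norm (x k.+1 - a *: x k) +
                                     l1norm (x k) * `|a|))).
  apply: ler_sum => k _; rewrite mulrC -l1normZ.
  by apply: le_trans (ler_l1normD _ _); rewrite subrK.
by rewrite big_split lerD2r.
Qed.

Lemma abs_summable_exp (n : nat) (A : 'M[C]_n) :
  (forall a, eigenvalue A a -> `|a| < 1) -> abs_summable (fun k => A ^+ k).
Proof.
case: n A => [|n] A A1.
  by exists 0 => N; rewrite big1 // => k _; rewrite flatmx0 l1norm0.
have [r char_r] := closed_field_poly_normal (char_poly A).
rewrite (monicP (char_poly_monic A)) scale1r in char_r.
have r1 a : a \in r -> `|a| < 1.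
  by move=> ar; apply: A1; rewrite eigenvalue_root_char char_r root_prod_XsubC.
have CH : \prod_(a <- r) (A - a%:M) = 0.
  rewrite -(Cayley_Hamilton A) char_r rmorph_prod; apply: eq_bigr => a _.
  by rewrite rmorphB /= horner_mx_X horner_mx_C.
(* The right factor [X] is arbitrary so that induction applies. With [x k] equal to [A ^+ k] times
   the remaining product times [X], the difference [x k.+1 - a *: x k] carries the extra factor
   [A - a%:M], so the recurrence lemma removes that factor. *)
have peel (s : seq C) (X : 'M[C]_n.+1) : (forall a, a \in s -> `|a| < 1) ->
    abs_summable (fun k => A ^+ k * (\prod_(a <- s) (A - a%:M) * X)) ->
    abs_summable (fun k => A ^+ k * X).
  elim: s X => [|a s IHs] X s1; first by rewrite big_nil mul1r.
  rewrite big_cons -mulrA => sumX; apply: IHs.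
    by move=> b bs; apply: s1; rewrite inE bs orbT.
  apply: (@abs_summable_recurrence _ _ _ a); first by apply: s1; rewrite mem_head.
  apply: abs_summable_le ler01 _ sumX => k; rewrite mul1r.
  rewrite [X in _ <= l1norm X](_ : _ = A ^+ k.+1 * (\prod_(a <- s) (A - a%:M) * X) -
    a *: (A ^+ k * (\prod_(a <- s) (A - a%:M) * X))) //.
  rewrite mulrBl mulrBr [in LHS]mulrA -exprSr; congr (_ - _).
  by rewrite scalerAr; congr (_ * _); exact: mul_scalar_mx.
have -> : (fun k => A ^+ k) = (fun k => A ^+ k * 1).
  by apply/funext => k; rewrite mulr1.
apply: (peel r) => //; rewrite CH mul0r.
under eq_fun do rewrite mulr0.
by have [] := has_sum0 R n.+1 n.+1.
Qed.

Lemma unitmx_resolvent (n : nat) (A : 'M[C]_n) (z : C) :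
  (z%:M - A \in unitmx) = ~~ eigenvalue A z.
Proof.
rewrite -row_free_unit /eigenvalue negbK /eigenspace kermx_eq0 /row_free.
by rewrite -opprB mxrank_opp.
Qed.

(** Telescoping: [z%:M - A] times the N-th partial sum is [1%:M - z *: v N], where [v] is the
    general term, and [v N] tends to 0 by summability. *)
Lemma has_sum_resolvent (n : nat) (A : 'M[C]_n) (z : C) :
  z%:M - A \in unitmx -> abs_summable (fun k => A ^+ k) -> `|z| = 1 ->
  has_sum (fun k => z^-1 ^+ k.+1 *: A ^+ k) (invmx (z%:M - A)).
Proof.
move=> zA sumA z1.
have z0 : z != 0 by rewrite -normr_eq0 z1 oner_eq0.
have sumz : abs_summable (fun k => z^-1 ^+ k.+1 *: A ^+ k).
  apply: abs_summable_le ler01 _ sumA => k.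
  by rewrite l1normZ normrX normfV z1 invr1 expr1n.
split => //.
pose v k : 'M[C]_n := z^-1 ^+ k.+1 *: A ^+ k.
have v0 : v k @[k --> \oo] --> (0 : 'M[C]_n).
  by apply: cvg_series_cvg_0; exact: is_cvg_series_mx.
have lim_v : 1%:M - z *: v k @[k --> \oo] --> (1%:M - z *: 0 : 'M[C]_n).
  by apply: cvgB; [exact: cvg_cst | apply: cvgZ v0; exact: cvg_cst].
have : invmx (z%:M - A) *m (1%:M - z *: v k) @[k --> \oo] -->
    invmx (z%:M - A) *m (1%:M - z *: 0).
  by apply: cvg_mulmx lim_v; exact: cvg_cst.
rewrite scaler0 subr0 mulmx1.
rewrite [series _](_ : _ = fun N => invmx (z%:M - A) *m (1%:M - z *: v N)) //.
apply/funext => N; apply: (canRL (mulKmx zA)); rewrite /series /=.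
elim: N => [|N IHN].
  by rewrite big_geq // mulmx0 /v expr1 expr0 scalerA divff // scale1r subrr.
rewrite big_nat_recr //= mulmxDr IHN /v mulmxBl mul_scalar_mx !scalerA.
rewrite -scalemxAr [A *m _](_ : _ = A ^+ N.+1); last by rewrite exprS.
rewrite addrA subrK; congr (_ - _ *: _).
by rewrite [in RHS]exprS mulrA divff ?mul1r.
Qed.

End PowerSeries.

(** * Minimal realizations *)

(** Cayley-Hamilton solved for the top power; it makes the row space spanned by the [K *m A ^+ i]
    with [i < n] invariant under [A]. *)
Lemma exp_char_poly (F : fieldType) (n : nat) (A : 'M[F]_n) :
  A ^+ n = \sum_(i < n) - (char_poly A)`_i *: A ^+ i.
Proof.
case: n A => [|n] A; first by rewrite big_ord0 [LHS]flatmx0.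
have := Cayley_Hamilton A.
rewrite -[X in horner_mx _ X]coefK poly_def size_char_poly big_ord_recr /= rmorphD /=.
have -> : (char_poly A)`_n.+1 = 1.
  by have /monicP := char_poly_monic A; rewrite lead_coefE size_char_poly.
rewrite scale1r rmorphXn /= horner_mx_X => /(canRL (addKr _)) ->; rewrite addr0.
rewrite rmorph_sum /= -sumrN. apply: eq_bigr => i _.
by rewrite linearZ /= rmorphXn /= horner_mx_X scaleNr.
Qed.

Section Realization.
Variable R : realType.
Local Notation C := (Cplx R).

Lemma finite_eigenvalues (n : nat) (A : 'M[C]_n) :
  finite_set [set z | eigenvalue A z].
Proof.
have [r char_r] := closed_field_poly_normal (char_poly A).
rewrite (monicP (char_poly_monic A)) scale1r in char_r.
rewrite [X in finite_set X](_ : _ = [set` r]); first exact: finite_seq.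
by apply/seteqP; split=> z /=;
   rewrite eigenvalue_root_char char_r root_prod_XsubC.
Qed.

(** A finite set without [z] is closed. Hence an identity valid off a finite set holds on a
    punctured neighbourhood of every point. *)
Lemma near_dnbhs_finite (S : set C) (z : C) : finite_set S ->
  \forall w \near z^', ~ S w.
Proof.
move=> Sfin.
have /closed_openC : closed (S `\ z).
  move: (S `\ z) (finite_setD [set z] Sfin); apply/accessible_finite_set_closed.
  by apply: hausdorff_accessible; exact: norm_hausdorff.
rewrite openE => /(_ z) /=; rewrite /interior => h.
have : nbhs z (~` (S `\ z)) by apply: h => -[_ /=]; apply.
rewrite /dnbhs /within /=; apply: filterS => w Sw wz Sw'; apply: Sw.
by split=> //=; apply/eqP.
Qed.

Section MinimalRealization.
Variables (p q n : nat) (M : C -> 'M[C]_(p, q)).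
Variables (A : 'M[C]_n) (B : 'M[C]_(n, q)) (K : 'M[C]_(p, n)) (D : 'M[C]_(p, q)).

(* Restricting a realization to an A-invariant space of row vectors that
   contains the rows of K gives a realization of size [\rank V]. *)
Lemma minimal_row_full (V : 'M[C]_n) : minimal_realization M A B K D ->
  (K <= V)%MS -> (V *m A <= V)%MS -> row_full V.
Proof.
move=> [rea minA] KV VA; rewrite /row_full eqn_leq rank_leq_col /=.
pose U := row_base V.
have /submxP[K' KE] : (K <= U)%MS by rewrite eq_row_base.
have /submxP[A' UA] : (U *m A <= U)%MS.
  by rewrite eq_row_base (eqmxMr _ (eq_row_base V)).
(* With [K = K' *m U] and [U *m A = A' *m U], the compressed system has the same transfer function
   wherever both resolvents exist. The exceptional set consists of the eigenvalues of [A] and [A']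
   and the points where the original realization fails. *)
apply: (minA _ A' (U *m B) K' D).
apply: sub_finite_set (_ : finite_set (([set z | eigenvalue A z] `|`
  [set z | eigenvalue A' z]) `|` [set z | M z != D + K *m invmx (z%:M - A) *m B])).
  move=> z /= neq; apply: contrapT => /not_orP[/not_orP[/negP zA /negP zA'] eqM].
  rewrite -unitmx_resolvent in zA; rewrite -unitmx_resolvent in zA'.
  move/negP: eqM; rewrite negbK => /eqP eqM; move: neq; rewrite eqM.
  have UR : U *m invmx (z%:M - A) = invmx (z%:M - A') *m U.
    apply: (canRL (mulKmx zA')); rewrite mulmxA; apply: (canLR (mulmxK zA)).
    by rewrite mulmxBl mulmxBr -UA scalar_mxC.
  by rewrite KE -(mulmxA K') UR !mulmxA eqxx.
by rewrite !finite_setU; split=> //; split; exact: finite_eigenvalues.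
Qed.

(** The row space [V] of all [K *m A ^+ i] contains [K] and is [A]-invariant, so minimality makes it
    the whole space; the [W i] are the coefficients of the identity in it. *)
Lemma minimal_observable : minimal_realization M A B K D ->
  exists W : 'I_n -> 'M[C]_(n, p), 1%:M = \sum_i W i *m (K *m A ^+ i).
Proof.
move=> minM; pose V := (\sum_(i < n) <<K *m A ^+ i>>)%MS.
(* The case [k = n] is the one that invariance needs: multiplying the last generator by [A] produces
   the power [n]. *)
have subV k : (k <= n)%N -> (K *m A ^+ k <= V)%MS.
  have subV_lt j : (j < n)%N -> (K *m A ^+ j <= V)%MS.
    by move=> jn; apply: (sumsmx_sup (Ordinal jn)); rewrite ?genmxE.
  rewrite leq_eqVlt => /predU1P[->|/subV_lt //].
  rewrite exp_char_poly mulmx_sumr; apply: summx_sub => i _.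
  by rewrite -scalemxAr scalemx_sub // subV_lt.
have /row_fullP[W] : row_full V.
  apply: minimal_row_full => //.
    case: (posnP n) => [n0|n0]; last by have := subV 0%N (leq0n _); rewrite expr0 mulmx1.
    have K0 : K = 0 by apply/matrixP => i j; have := ltn_ord j; rewrite {2}n0.
    by rewrite K0 sub0mx.
  rewrite sumsmxMr; apply/sumsmx_subP => i _.
  by rewrite (eqmxMr _ (genmxE _)) -mulmxA -[_ *m A]exprSr subV.
move=> WV; have : (1%:M <= V)%MS by rewrite -WV submxMl.
move=> /sub_sumsmxP[u ->].
have /all_sig[w wE] (i : 'I_n) : {w : 'M[C]_(n, p) | u i *m <<K *m A ^+ i>>%MS =
    w *m (K *m A ^+ i)}.
  by apply: cid; apply/submxP; rewrite (submx_trans (submxMl _ _)) ?genmxE.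
by exists w; apply: eq_bigr => i _.
Qed.

End MinimalRealization.

(** Duality: transposition exchanges [B] and [K] and is an involution on realizations, so
    controllability reduces to observability. *)
Lemma minimal_realization_trmx (p q n : nat) (M : C -> 'M[C]_(p, q))
    (A : 'M[C]_n) (B : 'M[C]_(n, q)) (K : 'M[C]_(p, n)) (D : 'M[C]_(p, q)) :
  minimal_realization M A B K D ->
  minimal_realization (fun z => (M z)^T) A^T K^T B^T D^T.
Proof.
have tr (p' q' n' : nat) (M' : C -> 'M[C]_(p', q')) A' (B' : 'M[C]_(n', q')) K' D' :
    realization M' A' B' K' D' ->
    realization (fun z => (M' z)^T) A'^T K'^T B'^T D'^T.
  apply: sub_finite_set => z /=; apply: contra_neq => ->.
  by rewrite raddfD /= !trmx_mul trmx_inv raddfB /= tr_scalar_mx mulmxA.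
move=> [rea minA]; split; first exact: tr.
move=> n' A' B' K' D' /tr; under eq_fun do rewrite trmxK.
exact: minA.
Qed.

Lemma minimal_controllable (p q n : nat) (M : C -> 'M[C]_(p, q))
    (A : 'M[C]_n) (B : 'M[C]_(n, q)) (K : 'M[C]_(p, n)) (D : 'M[C]_(p, q)) :
  minimal_realization M A B K D ->
  exists W : 'I_n -> 'M[C]_(q, n), 1%:M = \sum_(i < n) A ^+ i *m B *m W i.
Proof.
move=> /minimal_realization_trmx/minimal_observable[W WE].
exists (fun i => (W i)^T); rewrite -[LHS]trmxK trmx1 WE raddf_sum /=.
apply: eq_bigr => i _; rewrite !trmx_mul trmxK.
congr (_ *m _ *m _); elim: (nat_of_ord i) => [|k IHk].
  by rewrite !expr0 trmx1.
by rewrite exprSr exprS -[in RHS]IHk trmx_mul trmxK.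
Qed.

(* A finite limit of M at z makes K A^m (w - A)^-1 B converge for every m, as
   K A^(m+1) (w - A)^-1 B = w K A^m (w - A)^-1 B - K A^m B; by observability and
   controllability (w - A)^-1 then converges too. *)
Lemma minimal_resolvent_limit (p q n : nat) (M : C -> 'M[C]_(p, q))
    (A : 'M[C]_n) (B : 'M[C]_(n, q)) (K : 'M[C]_(p, n)) (D L : 'M[C]_(p, q))
    (z : C) :
  minimal_realization M A B K D -> M w @[w --> z^'] --> L ->
  z%:M - A \in unitmx /\ L = D + K *m invmx (z%:M - A) *m B.
Proof.
move=> minM ML.
have [W WE] := minimal_observable minM.
have [Z ZE] := minimal_controllable minM.
pose r w := invmx (w%:M - A).
have near_unit : \forall w \near z^', w%:M - A \in unitmx.
  have := near_dnbhs_finite z (finite_eigenvalues A).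
  by apply: filterS => w /negP; rewrite unitmx_resolvent.
have near_M : \forall w \near z^', M w = D + K *m r w *m B.
  by have := near_dnbhs_finite z (proj1 minM); apply: filterS => w /negP;
     rewrite negbK => /eqP.
have z_cvg : w @[w --> z^'] --> z by apply: cvg_within.
have KAr m : exists X : 'M[C]_(p, q), K *m A ^+ m *m r w *m B @[w --> z^'] --> X.
  elim: m => [|m [X Xlim]].
    exists (L - D); rewrite expr0 mulmx1.
    have : M w - D @[w --> z^'] --> L - D by apply: cvgB ML _; exact: cvg_cst.
    apply: cvg_trans; apply: near_eq_cvg; apply: filterS near_M => w ->.
    by rewrite addrC addKr.
  exists (z *: X - K *m A ^+ m *m B).
  have : w *: (K *m A ^+ m *m r w *m B) - K *m A ^+ m *m B @[w --> z^'] -->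
         z *: X - K *m A ^+ m *m B.
    by apply: cvgB; [exact: cvgZ z_cvg Xlim | exact: cvg_cst].
  apply: cvg_trans; apply: near_eq_cvg; apply: filterS near_unit => w wA.
  have -> : K *m A ^+ m.+1 *m r w = K *m A ^+ m *m (w *: r w - 1%:M).
    rewrite exprSr -mulmxE !mulmxA -(mulmxA _ A); congr (_ *m _).
    rewrite -[in RHS](mulmxV wA) -/(r w) -mul_scalar_mx mulmxBl.
    by rewrite opprB addrC subrK.
  by rewrite mulmxBr mulmx1 mulmxBl -scalemxAr -scalemxAl.
have [X /= Xlim] : exists X : 'M[C]_n, r w @[w --> z^'] --> X.
  have /choice[Y Ylim] := KAr.
  (* Insert both expansions of the identity around [r w]. Since [A] commutes with [r w], the powers
     on the two sides merge into [A ^+ (i + j)], and each summand converges by [KAr]. *)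
  exists (\sum_(i < n) \sum_(j < n) W i *m Y (i + j)%N *m Z j).
  have : \sum_(i < n) \sum_(j < n) W i *m (K *m A ^+ (i + j) *m r w *m B) *m Z j
      @[w --> z^'] --> \sum_(i < n) \sum_(j < n) W i *m Y (i + j)%N *m Z j.
    apply: cvgr_sum => i _; apply: cvgr_sum => j _.
    apply: cvg_mulmx; last exact: cvg_cst.
    by apply: cvg_mulmx; [exact: cvg_cst | exact: Ylim].
  apply: cvg_trans; apply: near_eq_cvg; apply: filterS near_unit => w wA.
  rewrite -[RHS]mulmx1 -[X in _ = X *m _]mul1mx {1}WE ZE mulmx_suml.
  rewrite mulmx_suml; apply: eq_bigr => i _; rewrite mulmx_sumr.
  apply: eq_bigr => j _; rewrite !mulmxA; congr (_ *m _ *m _).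
  rewrite exprD -mulmxE -!mulmxA; congr (_ *m (_ *m (_ *m _))).
  have rA : A *m r w = r w *m A.
    apply: (canRL (mulKmx wA)); rewrite mulmxA; apply: (canLR (mulmxK wA)).
    by rewrite mulmxBl mulmxBr scalar_mxC.
  elim: (nat_of_ord j) => [|k IHk]; first by rewrite expr0 mul1mx mulmx1.
  by rewrite exprS -mulmxE mulmxA -rA -mulmxA IHk mulmxA.
(* The identity [(w%:M - A) *m r w = 1%:M] passes to the limit, so the limit of the resolvents
   inverts [z%:M - A]. *)
have zX : (z%:M - A) *m X = 1%:M.
  have lim1 : (w%:M - A) *m r w @[w --> z^'] --> (z%:M - A) *m X.
    apply: cvg_mulmx Xlim; apply: cvgB; last exact: cvg_cst.
    have : w *: (1%:M : 'M[C]_n) @[w --> z^'] --> z *: (1%:M : 'M[C]_n).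
      by apply: cvgZ z_cvg _; exact: cvg_cst.
    by rewrite scalemx1; under eq_fun do rewrite scalemx1.
  apply: (cvg_unique _ lim1); first exact: norm_hausdorff.
  have : (1%:M : 'M[C]_n) @[w --> z^'] --> (1%:M : 'M[C]_n) by exact: cvg_cst.
  apply: cvg_trans; apply: near_eq_cvg; apply: filterS near_unit => w wA.
  by rewrite mulmxV.
have [zA _] := mulmx1_unit zX.
split=> //; have -> : invmx (z%:M - A) = X.
  by rewrite -[LHS]mulmx1 -zX mulKmx.
apply: (cvg_unique _ ML); first exact: norm_hausdorff.
have : D + K *m r w *m B @[w --> z^'] --> D + K *m X *m B.
  apply: cvgD; first exact: cvg_cst.
  apply: cvg_mulmx; last exact: cvg_cst.
  by apply: cvg_mulmx Xlim; exact: cvg_cst.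
by apply: cvg_trans; apply: near_eq_cvg; apply: filterS near_M => w ->.
Qed.

(** The limit is punctured because the realization formula may a priori fail at [z] itself;
    continuity of [M] then transfers the formula to [z]. *)
Lemma analytic_at_cvg (p q : nat) (M : C -> 'M[C]_(p, q)) (z : C) :
  analytic_at M z -> M w @[w --> z^'] --> M z.
Proof.
move=> /nbhs_singleton/derivable1_diffP/differentiable_continuous Mz.
by apply: cvg_trans Mz; apply: cvg_app; apply: cvg_within.
Qed.

End Realization.

(** * Uniqueness of Fourier coefficients *)

(** In characteristic 0 the polynomial ['X^N - 1] is separable, so it has [N] distinct roots, and a
    group of [N] roots of unity in a field is cyclic. *)
Lemma prim_root_exists (F : numClosedFieldType) (N : nat) : (0 < N)%N ->
  exists w : F, N.-primitive_root w.
Proof.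
move=> N0; pose P : {poly F} := 'X^N - 1.
have [r Pr] := closed_field_poly_normal P.
rewrite (monicP _) ?monicXnsubC // scale1r in Pr.
have r1 : all N.-unity_root r.
  by apply/allP => w; rewrite -root_prod_XsubC -Pr.
have r_size : (N < (size r).+1)%N.
  by rewrite -(size_prod_XsubC r id) -Pr size_XnsubC.
have [|w wN] := hasP (has_prim_root N0 r1 _ r_size); last by exists w.
by rewrite -separable_prod_XsubC -Pr separable_Xn_sub_1 // pnatr_eq0 -lt0n.
Qed.

(* [N * p`_i] is the sum of [w ^ (-i j) * p.[w ^ j]] over j < N, for w a primitive
   N-th root of unity with N > i, N >= size p. *)
Lemma coef_le_unit_circle (F : numClosedFieldType) (p : {poly F}) (e : F) :
  (forall z, `|z| = 1 -> `|p.[z]| <= e) -> forall i, `|p`_i| <= e.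
Proof.
move=> pe i; set N := (i + size p).+1.
have [w wN] := @prim_root_exists F N isT.
have w1 : `|w| = 1.
  apply: (@pexpIrn _ N) => //; rewrite ?nnegrE ?normr_ge0 ?ler01 //.
  by rewrite -normrX (prim_expr_order wN) normr1 expr1n.
have iN : (i < N)%N by rewrite ltnS leq_addr.
(* The exponent [N - i] plays the role of [- i], since [w ^+ N = 1]. *)
have sumE : N%:R * p`_i = \sum_(j < N) w ^+ (N - i) ^+ j * p.[w ^+ j].
  transitivity (\sum_(l < N) p`_l * \sum_(j < N) (w ^+ (N - i + l)) ^+ j).
    rewrite (bigD1 (Ordinal iN)) //= [X in _ + X]big1 ?addr0 => [|l li].
      rewrite subnK ?(ltnW iN) // (prim_expr_order wN) mulrC.
      under eq_bigr do rewrite expr1n.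
      by rewrite sumr_const card_ord.
    (* A geometric sum whose ratio is an N-th root of unity vanishes unless the ratio is 1. As
       [0 < N - i + l < 2 N], ratio 1 would force [l = i]. *)
    suff -> : \sum_(j < N) (w ^+ (N - i + l)) ^+ j = 0 by rewrite mulr0.
    have : (w ^+ (N - i + l) - 1) * \sum_(j < N) (w ^+ (N - i + l)) ^+ j = 0.
      by rewrite -subrX1 -exprM mulnC exprM (prim_expr_order wN) expr1n subrr.
    move/eqP; rewrite mulf_eq0 subr_eq0 => /orP[|/eqP //].
    rewrite -(prim_order_dvd wN) => /dvdnP[k Nk].
    case/negP: li; apply/eqP/val_inj => /=; have lN := ltn_ord l.
    by case: k Nk => [|[|k]] /=; nia.
  under eq_bigr do rewrite mulr_sumr.
  rewrite exchange_big /=; apply: eq_bigr => j _.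
  rewrite (@horner_coef_wide _ N p); last by rewrite ltnW // ltnS leq_addl.
  rewrite mulr_sumr; apply: eq_bigr => l _.
  by rewrite exprD exprMn [in LHS](exprAC _ l j) mulrCA.
have N0 : 0 < N%:R :> F by rewrite ltr0n.
rewrite -(ler_pM2l N0) -{1}(normr_nat F N) -normrM sumE.
apply: le_trans (ler_norm_sum _ _ _) _.
rewrite mulr_natl -[N in leRHS]card_ord -sumr_const; apply: ler_sum => j _.
rewrite normrM !normrX w1 !expr1n mul1r; apply: pe.
by rewrite normrX w1 expr1n.
Qed.

(** Multiplication by [z ^+ N], of modulus 1 on the circle, gives the polynomial [p]. The exponents
    [N - k] and [N + k.+1] are pairwise distinct for [k < N], so the coefficients of [p] are those
    of [d]. *)
Lemma laurent_coef_le (F : numClosedFieldType) (N : nat) (d : int -> F) (e : F) :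
  (forall z, `|z| = 1 -> `|\sum_(k < N) (z ^ (- Posz k) * d (Posz k) +
                                        z ^ (- Negz k) * d (Negz k))| <= e) ->
  forall m, (m < N)%N -> `|d (Posz m)| <= e /\ `|d (Negz m)| <= e.
Proof.
move=> de m mN.
pose p := \sum_(k < N) (d (Posz k) *: 'X^(N - k) + d (Negz k) *: 'X^(N + k.+1)).
have pe z : `|z| = 1 -> `|p.[z]| <= e.
  move=> z1; have z0 : z != 0 by rewrite -normr_eq0 z1 oner_eq0.
  suff -> : p.[z] = z ^+ N * \sum_(k < N) (z ^ (- Posz k) * d (Posz k) +
                                          z ^ (- Negz k) * d (Negz k)).
    by rewrite normrM normrX z1 expr1n mul1r; apply: de.
  rewrite horner_sum mulr_sumr; apply: eq_bigr => k _.
  rewrite !hornerE mulrDr !mulrA; congr (_ + _); rewrite mulrC; congr (_ * _).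
    by rewrite -exprnN expfB.
  by rewrite NegzE opprK -exprnP exprD.
have coefp i : p`_i = \sum_(k < N) (d (Posz k) * (i == N - k)%N%:R +
                                    d (Negz k) * (i == N + k.+1)%N%:R).
  by rewrite coef_sum; apply: eq_bigr => k _; rewrite coefD !coefZ !coefXn.
split.
  suff <- : p`_(N - m) = d (Posz m) by apply: coef_le_unit_circle.
  rewrite coefp (bigD1 (Ordinal mN)) //= eqxx mulr1.
  have -> : (N - m == N + m.+1)%N = false by apply/eqP; lia.
  rewrite mulr0 addr0 big1 ?addr0 // => k km; have kN := ltn_ord k.
  have {}km : nat_of_ord k <> m by move=> h; case/eqP: km; apply: val_inj.
  have -> : (N - m == N - k)%N = false by apply/eqP; lia.
  have -> : (N - m == N + k.+1)%N = false by apply/eqP; lia.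
  by rewrite !mulr0 addr0.
suff <- : p`_(N + m.+1) = d (Negz m) by apply: coef_le_unit_circle.
rewrite coefp (bigD1 (Ordinal mN)) //= eqxx mulr1.
have -> : (N + m.+1 == N - m)%N = false by apply/eqP; lia.
rewrite mulr0 add0r big1 ?addr0 // => k km; have kN := ltn_ord k.
have {}km : nat_of_ord k <> m by move=> h; case/eqP: km; apply: val_inj.
have -> : (N + m.+1 == N - k)%N = false by apply/eqP; lia.
have -> : (N + m.+1 == N + k.+1)%N = false by apply/eqP; lia.
by rewrite !mulr0 addr0.
Qed.

Lemma normr_coord_le_mx_norm (K : numFieldType) (m n : nat) (A : 'M[K]_(m, n)) i j :
  `|A i j| <= `|A|.
Proof.
have : mx_norm A <= mx_norm A by [].
by rewrite {1}mx_normE num_le => /bigmax_leP[_ /(_ (i, j) isT)].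
Qed.

Section FourierUniqueness.
Variable R : realType.
Local Notation C := (Cplx R).

Lemma zsum_to_symmetric (m n : nat) (u : int -> 'M[C]_(m, n)) s :
  zsum_to u s ->
  \sum_(k < N) (u (Posz k) + u (Negz k)) @[N --> \oo] --> s.
Proof.
move=> [_ _ [s1 [s2 [us1 us2 ->]]]].
rewrite (_ : (fun N => _) = fun N => series (fun k => u (Posz k)) N +
  series (fun k => u (Negz k)) N); first exact: (cvgD us1 us2).
by apply/funext => N; rewrite /series /= !big_mkord big_split.
Qed.

(** Cauchy criterion: both partial sums lie within [e / 2] of the limit. Used at [z = 1], it bounds
    the tails of a Fourier series uniformly on the circle, as the norms of the terms do not depend
    on [z]. *)
Lemma zsum_to_tail (m n : nat) (u : int -> 'M[C]_(m, n)) s (e : C) :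
  zsum_to u s -> 0 < e -> \forall N0 \near \oo, forall N, (N0 <= N)%N ->
    \sum_(N0 <= k < N) (`|u (Posz k)| + `|u (Negz k)|) <= e.
Proof.
move=> [cpos cneg _] e0.
have : cvgn (fun N => [normed series (fun k => u (Posz k))] N +
                      [normed series (fun k => u (Negz k))] N).
  exact: (is_cvgD cpos cneg).
move=> /cvg_ex[l /cvgrPdist_lt /(_ (e / 2))]; rewrite divr_gt0 // => /(_ isT).
move=> [N1 _ lN1]; exists N1 => // N0 /= N10 N N0N.
have := ltrD (lN1 _ N10) (lN1 _ (leq_trans N10 N0N)).
rewrite -splitr distrC => /ltW; apply: le_trans.
rewrite addrC; apply: le_trans (ler_normD _ _).
rewrite addrC addrA subrK distrC.
have -> : [normed series (fun k => u (Posz k))] N + [normed series (fun k => u (Negz k))] N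
    - ([normed series (fun k => u (Posz k))] N0 + [normed series (fun k => u (Negz k))] N0)
    = \sum_(N0 <= k < N) (`|u (Posz k)| + `|u (Negz k)|).
  by rewrite /= opprD addrACA !sub_series_geq // big_split.
by rewrite ger0_norm //; apply: sumr_ge0 => k _; apply: addr_ge0.
Qed.

(** The partial sums of the series with coefficients [c - d] tend to 0 at each point of the circle,
    and the tail bounds make this uniform. Every coefficient is then bounded by every positive
    [e]. *)
Lemma fourier_expansion_unique (q : nat) (F : C -> 'M[C]_q) (c d : int -> 'M[C]_q) :
  fourier_expansion F c -> fourier_expansion F d -> c =1 d.
Proof.
move=> Fc Fd; pose g k := c k - d k.
have norm_unit (z : C) k (A : 'M[C]_q) : `|z| = 1 -> `|z ^ k *: A| = `|A|.
  move=> z1; rewrite normrZ; suff -> : `|exprz z k| = 1 by rewrite mul1r.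
  by case: k => k; rewrite ?NegzE -?exprnN ?normfV normrX z1 expr1n ?invr1.
pose S (z : C) N0 N : 'M[C]_q := \sum_(N0 <= k < N) (z ^ (- Posz k) *: g (Posz k) +
                                           z ^ (- Negz k) *: g (Negz k)).
have S0 z : `|z| = 1 -> S z 0%N N @[N --> \oo] --> (0 : 'M[C]_q).
  move=> z1; rewrite -(subrr (F z)).
  apply: cvg_trans (cvgB (zsum_to_symmetric (Fc z z1)) (zsum_to_symmetric (Fd z z1))).
  apply: near_eq_cvg; apply: filterE => N.
  rewrite /S big_mkord fctE /= -sumrB; apply: eq_bigr => k _.
  by rewrite /g !scalerBr opprD addrACA.
(* [N0] is chosen from the tails at [z = 1], before [z]; only the auxiliary [N] depends on [z]. The
   three thirds of [e] pay for [S z 0 N] and for the tails of [c] and [d]. *)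
have small e : 0 < e -> \forall N0 \near \oo, forall z, `|z| = 1 -> `|S z 0%N N0| <= e.
  move=> e0; have e3 : 0 < e / 3 by rewrite divr_gt0.
  have n1 : `|1 : C| = 1 by exact: normr1.
  apply: filterS2 (zsum_to_tail (Fc 1 n1) e3) (zsum_to_tail (Fd 1 n1) e3).
  move=> N0 tc td z z1.
  have /cvgr0Pnorm_lt/(_ _ e3) := S0 z z1.
  move=> [N1 _ /(_ (maxn N0 N1) (leq_maxr _ _)) /ltW].
  move: (tc (maxn N0 N1) (leq_maxl _ _)) (td (maxn N0 N1) (leq_maxl _ _)).
  set N := maxn N0 N1 => {}tc {}td SN.
  have -> : S z 0%N N0 = S z 0%N N - S z N0 N.
    by rewrite /S (big_cat_nat (leq0n N0) (leq_maxl _ _)) /= addrK.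
  have -> : e = e / 3 + (e / 3 + e / 3) by field.
  apply: le_trans (ler_normB _ _) _; apply: lerD => //.
  apply: le_trans (lerD tc td); apply: le_trans (ler_norm_sum _ _ _) _.
  rewrite -big_split /=; apply: ler_sum => k _.
  apply: le_trans (ler_normD _ _) _; rewrite !norm_unit // addrACA.
  by apply: lerD; exact: ler_normB.
have g_small k (i j : 'I_q) e : 0 < e -> `|g k i j| <= e.
  move=> e0; have [N1 _ SN1] := small e e0.
  pose m := match k with Posz m => m | Negz m => m end.
  pose N := maxn N1 m.+1.
  have Sle (z : C) : `|z| = 1 -> `|\sum_(l < N) (z ^ (- Posz l) * g (Posz l) i j +
      z ^ (- Negz l) * g (Negz l) i j)| <= e.
    move=> z1; apply: le_trans (SN1 N (leq_maxl _ _) z z1).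
    apply: le_trans (normr_coord_le_mx_norm _ i j).
    rewrite /S big_mkord summxE le_eqVlt; apply/orP; left; apply/eqP.
    by congr `|_|; apply: eq_bigr => l _; rewrite !mxE.
  have [] := laurent_coef_le (d := fun l => g l i j) Sle (leq_maxr N1 m.+1).
  by rewrite /m; case: (k).
move=> k; apply/eqP; rewrite -subr_eq0; apply/eqP/matrixP => i j; rewrite !mxE.
apply/eqP; rewrite -normr_le0; apply/ler_addgt0Pl => e e0; rewrite addr0.
by have := g_small k i j e e0; rewrite !mxE.
Qed.

End FourierUniqueness.

(** * The expansion of F(z)* F(z) *)

Section SpectralFactor.
Variable R : realType.
Local Notation C := (Cplx R).

Lemma adjointM (m n p : nat) (A : 'M[C]_(m, n)) (B : 'M[C]_(n, p)) :
  (A *m B) ^t* = B ^t* *m A ^t*.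
Proof. by rewrite trmx_mul map_mxM. Qed.

Lemma adjointD (m n : nat) (A B : 'M[C]_(m, n)) : (A + B) ^t* = A ^t* + B ^t*.
Proof. by rewrite !raddfD. Qed.

Lemma adjointB (m n : nat) (A B : 'M[C]_(m, n)) : (A - B) ^t* = A ^t* - B ^t*.
Proof. by rewrite !raddfB. Qed.

Lemma adjointZ (m n : nat) (a : C) (A : 'M[C]_(m, n)) :
  (a *: A) ^t* = a^* *: A ^t*.
Proof. by rewrite linearZ map_mxZ. Qed.

Lemma adjointK (m n : nat) (A : 'M[C]_(m, n)) : A ^t* ^t* = A.
Proof. by apply/matrixP => i j; rewrite !mxE conjCK. Qed.

Lemma adjoint1 (n : nat) : (1%:M : 'M[C]_n) ^t* = 1%:M.
Proof. by rewrite trmx1 map_mx1. Qed.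

Lemma adjoint_exp (n : nat) (A : 'M[C]_n) k : (A ^+ k) ^t* = A ^t* ^+ k.
Proof.
elim: k => [|k IHk]; first by rewrite !expr0 adjoint1.
by rewrite exprSr exprS -mulmxE adjointM IHk.
Qed.

Lemma conj_unit_circle (z : C) : `|z| = 1 -> z^* = z^-1.
Proof. by move=> z1; rewrite invC_norm z1 expr1n invr1 mul1r. Qed.

(** * The observability Gramian and its Stein equation *)

Section Gramian.
Variables (p n : nat) (A : 'M[C]_n) (K : 'M[C]_(p, n)).
Hypothesis A_summable : abs_summable (fun k => A ^+ k).

(** In each term one power of [A] is bounded and the other is summable. *)
Lemma has_sum_gramian : has_sum (gramian_term A K) (gramian A K).
Proof.
apply: abs_summable_has_sum.
have [b b0 Ab] := abs_summable_bounded A_summable.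
apply: abs_summable_le (_ : 0 <= b * l1norm (K ^t* *m K)) _ A_summable => [|k].
  by rewrite mulr_ge0 ?l1norm_ge0.
rewrite /gramian_term -adjoint_exp -!mulmxA mulmxA -mulmxA.
apply: le_trans (ler_l1normM _ _) _; rewrite l1norm_adjoint -mulrA.
apply: ler_pM; rewrite ?l1norm_ge0 ?Ab // mulmxA.
exact: ler_l1normM.
Qed.

(** Splitting off the term [u = 0] leaves the same series multiplied by [A ^t*] on the left and [A]
    on the right. *)
Lemma gramian_stein : gramian A K = K ^t* *m K + A ^t* *m gramian A K *m A.
Proof.
apply: has_sum_unique has_sum_gramian _.
have -> : K ^t* *m K = gramian_term A K 0.
  by rewrite /gramian_term !expr0 mul1mx mulmx1.
apply: has_sum_cons.
have := has_sum_mulmx (A ^t*) A has_sum_gramian.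
rewrite [X in has_sum X _ -> _](_ : _ = fun k => gramian_term A K k.+1) //.
by apply/funext => k; rewrite /gramian_term exprS exprSr -!mulmxE !mulmxA.
Qed.

Lemma gramian_hermitian : (gramian A K) ^t* = gramian A K.
Proof.
apply: has_sum_unique (has_sum_adjoint has_sum_gramian) _.
rewrite [X in has_sum X _](_ : _ = gramian_term A K); first exact: has_sum_gramian.
apply/funext => k; rewrite /gramian_term -adjoint_exp !adjointM !adjointK.
by rewrite !mulmxA.
Qed.

(* With r = (z - A)^-1: substitute K* K = G - A* G A and A r = z r - 1. *)
Lemma gramian_resolvent (z : C) : `|z| = 1 -> z%:M - A \in unitmx ->
  let r := invmx (z%:M - A) in let G := gramian A K in
  r ^t* *m (K ^t* *m K) *m r = G + r ^t* *m A ^t* *m G + G *m A *m r.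
Proof.
move=> z1 zA r G.
have z0 : z != 0 by rewrite -normr_eq0 z1 oner_eq0.
have Ar : A *m r = z *: r - 1%:M.
  by rewrite -(mulmxV zA) mulmxBl mul_scalar_mx opprB addrC subrK.
have rA : r ^t* *m A ^t* = z^-1 *: r ^t* - 1%:M.
  by rewrite -adjointM Ar adjointB adjointZ adjoint1 conj_unit_circle.
have -> : K ^t* *m K = G - A ^t* *m G *m A.
  by rewrite {1}/G gramian_stein addrK.
have -> : r ^t* *m (G - A ^t* *m G *m A) *m r =
    r ^t* *m G *m r - (r ^t* *m A ^t*) *m G *m (A *m r).
  by rewrite mulmxBr mulmxBl !mulmxA.
(* The terms [r ^t* *m G *m r] cancel because [z^-1 * z = 1]; what remains on both sides is
   [z^-1 *: r ^t* *m G + z *: G *m r - G]. *)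
rewrite -(mulmxA G A r) rA Ar !mulmxBl !mulmxBr !mul1mx !mulmx1.
rewrite -!scalemxAl -!scalemxAr !scalerA mulVf // scale1r.
rewrite opprB opprB addrCA (addrC _ (_ - r ^t* *m G *m r)) subrK.
by rewrite (addrC G) subrK addrC.
Qed.

End Gramian.

(** * Fourier coefficients of the product and correlation of Markov parameters *)

Section Product.
Variables (p q n : nat).
Variables (A : 'M[C]_n) (B : 'M[C]_(n, q)) (K : 'M[C]_(p, n)) (D : 'M[C]_(p, q)).
Hypothesis A_summable : abs_summable (fun k => A ^+ k).

Local Notation G := (gramian A K).
Local Notation Y := (D ^t* *m K + B ^t* *m G *m A).

(** [Negz k] is [- k.+1], so its value is the adjoint of the value at [k.+1]. This symmetry lets the
    negative half be derived from the positive one. *)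
Definition product_coef (k : int) : 'M[C]_q :=
  match k with
  | Posz 0 => D ^t* *m D + B ^t* *m G *m B
  | Posz k.+1 => Y *m A ^+ k *m B
  | Negz k => (Y *m A ^+ k *m B) ^t*
  end.

Lemma product_coefE k : product_coef k =
  if k < 0 then B ^t* *m (A ^t*) ^+ `|(- k - 1)%R|%N *m Y ^t*
  else if k == 0 then D ^t* *m D + B ^t* *m G *m B
  else Y *m A ^+ `|(k - 1)%R|%N *m B.
Proof.
case: k => [[|k]|k]; first by [].
  rewrite -[RHS]/(Y *m A ^+ `|(Posz k.+1 - 1)%R|%N *m B).
  by have -> : (Posz k.+1 - 1)%R = Posz k by lia.
rewrite -[RHS]/(B ^t* *m (A ^t*) ^+ `|(- Negz k - 1)%R|%N *m Y ^t*).
have -> : (- Negz k - 1)%R = Posz k by lia.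
by rewrite /product_coef (adjointM (_ *m _)) adjointM adjoint_exp mulmxA.
Qed.

Lemma adjoint_Y : Y ^t* = K ^t* *m D + A ^t* *m G *m B.
Proof.
by rewrite adjointD !adjointM !adjointK gramian_hermitian // mulmxA.
Qed.

(** The quadratic term of the expanded product is replaced through [gramian_resolvent]: it
    contributes [B ^t* *m G *m B] and two terms linear in the resolvent, which complete the cross
    terms with [D] to [Y *m r *m B] and its adjoint. *)
Lemma product_on_circle (z : C) : `|z| = 1 -> z%:M - A \in unitmx ->
  let r := invmx (z%:M - A) in let F := D + K *m r *m B in
  F ^t* *m F = D ^t* *m D + B ^t* *m G *m B + Y *m r *m B + (Y *m r *m B) ^t*.
Proof.
move=> z1 zA r F.
have key := gramian_resolvent K A_summable z1 zA.
rewrite adjointM (adjointM Y) adjoint_Y /F adjointD !adjointM.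
rewrite !mulmxDl !mulmxDr.
have -> : B ^t* *m (r ^t* *m K ^t*) *m (K *m r *m B) =
    B ^t* *m (r ^t* *m (K ^t* *m K) *m r) *m B by rewrite !mulmxA.
rewrite key !mulmxDr !mulmxDl !mulmxA.
rewrite -/r; by rewrite [LHS](AC (2*(1*3)) ((1*4)*(2*6)*(3*5))).
Qed.

(** The resolvent series gives the coefficients of positive index and its adjoint those of negative
    index, since conjugation sends [z^-1] to [z] on the circle. *)
Lemma fourier_expansion_product (F : C -> 'M[C]_(p, q)) :
  (forall z, `|z| = 1 -> z%:M - A \in unitmx /\
     F z = D + K *m invmx (z%:M - A) *m B) ->
  fourier_expansion (fun z => F z ^t* *m F z) product_coef.
Proof.
move=> FE z z1; have [zA ->] := FE z z1.
have sum_r := has_sum_mulmx Y B (has_sum_resolvent zA A_summable z1).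
rewrite product_on_circle //; apply: zsum_toI.
  have -> : D ^t* *m D + B ^t* *m G *m B = z ^ (- Posz 0) *: product_coef (Posz 0).
    by rewrite oppr0 expr0z scale1r.
  apply: has_sum_cons; move: sum_r.
  rewrite [X in has_sum X _ -> _](_ : _ =
    fun k => z ^ (- Posz k.+1) *: product_coef (Posz k.+1)) //.
  apply/funext => k /=.
  by rewrite -scalemxAr -scalemxAl -exprnN exprVn.
move: (has_sum_adjoint sum_r).
rewrite [X in has_sum X _ -> _](_ : _ =
    fun k => z ^ (- Negz k) *: product_coef (Negz k)) //.
apply/funext => k /=; rewrite -scalemxAr -scalemxAl adjointZ; congr (_ *: _).
by rewrite NegzE opprK -exprnP rmorphXn /= -conj_unit_circle // conjCK.
Qed.

(** For a shift [m >= 0] the term [j = 0] is [D ^t* *m h m], and the later terms are those of the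
    Gramian between [B ^t*] and [A ^+ m *m B]. A negative shift gives the adjoint of a positive one
    after reindexing. *)
Lemma zsum_to_markov k :
  zsum_to (fun j => (markov_param A B K D j) ^t* *m markov_param A B K D (j + k))
    (product_coef k).
Proof.
set h := markov_param A B K D.
have h0 : h 0 = D by [].
have hS j : h (Posz j.+1) = K *m A ^+ j *m B.
  rewrite -[LHS]/(K *m A ^+ `|(Posz j.+1 - 1)%R|%N *m B).
  by have -> : (Posz j.+1 - 1)%R = Posz j by lia.
have hN j : h (Negz j) = 0 by [].
have sum_pos m : has_sum (fun j => (h (Posz j)) ^t* *m h (Posz j + Posz m))
    (product_coef (Posz m)).
  have -> : product_coef (Posz m) = D ^t* *m h (Posz m) + B ^t* *m G *m (A ^+ m *m B).
    case: m => [|m] /=; first by rewrite h0 expr0 mul1mx.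
    by rewrite hS !mulmxDl exprS -mulmxE !mulmxA.
  rewrite -[D]h0 -[X in _ *m h X + _]add0r.
  apply: has_sum_cons (fun j => (h (Posz j)) ^t* *m h (Posz j + Posz m)) _ _.
  have := has_sum_mulmx (B ^t*) (A ^+ m *m B) (has_sum_gramian K A_summable).
  rewrite [X in has_sum X _ -> _](_ : _ =
    fun j => (h (Posz j.+1)) ^t* *m h (Posz j.+1 + Posz m)) //.
  apply/funext => j; rewrite -PoszD addSn !hS /gramian_term !adjointM adjoint_exp.
  by rewrite exprD -mulmxE !mulmxA.
have sum0 (u : nat -> 'M[C]_q) : (forall j, u j = 0) -> has_sum u 0.
  by move=> u0; rewrite (_ : u = fun=> 0); [exact: has_sum0 | apply/funext].
case: k => [m|m]; rewrite -[product_coef _]addr0; apply: zsum_toI.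
- exact: sum_pos.
- by apply: sum0 => j; rewrite hN trmx0 map_mx0 mul0mx.
(* For the shift [Negz m] the terms with [j < m.+1] vanish, because [h] is then taken at a negative
   index; the sum effectively starts at [j = m.+1]. *)
- have shift (u : nat -> 'M[C]_q) s l : (forall j, (j < l)%N -> u j = 0) ->
      has_sum (fun j => u (j + l)%N) s -> has_sum u s.
    elim: l u => [|l IHl] u u0 us.
      move: us; rewrite [X in has_sum X _ -> _](_ : _ = u) //.
      by apply/funext => j; rewrite addn0.
     have : has_sum u (u 0%N + s); last by rewrite u0 ?add0r.
    apply: has_sum_cons; apply: IHl => [j jl|]; first exact: u0.
    move: us; rewrite [X in has_sum X _ -> _](_ : _ = fun j => u (j + l).+1) //.
    by apply/funext => j; rewrite addnS.
  apply: (shift _ _ m.+1) => [j jm|].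
    have [i ->] : exists i, (Posz j + Negz m)%R = Negz i.
      by exists (m - j)%N; lia.
    by rewrite hN mulmx0.
  have := has_sum_adjoint (sum_pos m.+1).
  rewrite [X in has_sum X _ -> _](_ : _ =
    fun j => (h (Posz (j + m.+1))) ^t* *m h (Posz (j + m.+1) + Negz m)) //.
  apply/funext => j; rewrite adjointM adjointK -PoszD.
  by have -> : (Posz (j + m.+1) + Negz m)%R = Posz j by lia.
- by apply: sum0 => j; rewrite hN trmx0 map_mx0 mul0mx.
Qed.

End Product.
End SpectralFactor.

Theorem theorem4p1 (R : realType) (p q n : nat)
    (M : Cplx R -> 'M[Cplx R]_(p, q))
    (A : 'M[Cplx R]_n) (B : 'M[Cplx R]_(n, q))
    (C : 'M[Cplx R]_(p, n)) (D : 'M[Cplx R]_(p, q))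
    (M_rational : rational_mxfun M)
    (M_analytic : forall z : Cplx R, 1 <= `|z| -> analytic_at M z)
    (M_analytic_infinity : analytic_at_infinity M)
    (M_realization : minimal_realization M A B C D) :
  let h := markov_param A B C D in
  let Gamma := gramian A C in
  let Y := D ^t* *m C + B ^t* *m Gamma *m A in
  let MstarM := fun z : Cplx R => M z ^t* *m M z in
  (* Gamma and the coefficients c_n are well defined *)
  cvgn (series (gramian_term A C)) /\
  (exists c : int -> 'M[Cplx R]_q, fourier_expansion MstarM c) /\
  forall c : int -> 'M[Cplx R]_q, fourier_expansion MstarM c ->
    (forall k : int, zsum_to (fun j : int => h j ^t* *m h (j + k)) (c k)) /\
    (forall k : int,
       c k = if k < 0 then B ^t* *m (A ^t*) ^+ `|(- k - 1)%R|%N *m Y ^t*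
             else if k == 0 then D ^t* *m D + B ^t* *m Gamma *m B
             else Y *m A ^+ `|(k - 1)%R|%N *m B).
Proof.
move=> h Gamma Y MstarM.
have M_outside z : 1 <= `|z| ->
    z%:M - A \in unitmx /\ M z = D + C *m invmx (z%:M - A) *m B.
  by move=> /M_analytic/analytic_at_cvg; apply: minimal_resolvent_limit.
(* An eigenvalue of modulus at least 1 would make the resolvent singular at a point where
   [M_outside] asserts invertibility. *)
have A_summable : abs_summable (fun k => A ^+ k).
  apply: abs_summable_exp => a Aa; rewrite real_ltNge ?normr_real ?real1 //.
  by apply/negP => /M_outside[]; rewrite unitmx_resolvent Aa.
have M_expansion : fourier_expansion MstarM (product_coef A B C D).
  by apply: fourier_expansion_product => // z z1; apply: M_outside; rewrite z1.
split; first by apply: is_cvg_series_mx; have [] := has_sum_gramian C A_summable.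
split; first by exists (product_coef A B C D).
move=> c c_expansion.
(* Uniqueness identifies an arbitrary expansion with the explicit one, for which both formulas are
   already established. *)
have cE k : c k = product_coef A B C D k.
  exact: fourier_expansion_unique c_expansion M_expansion k.
split=> k; rewrite cE; first exact: zsum_to_markov.
exact: product_coefE.
Qed.
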